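(* Let $Q$ be a network with root $O$ satisfying the standing assumption in the context. Then the expanding search $S^*$, defined by $S^*(t)=Q[g_Q(t)]$, is optimal, i.e. $\sigma_{S^*}(Q)=\sigma(Q)$, and the deterministic (expanding) competitive ratio of $Q$ is $$\sigma(Q)=\sup_{r>0}\frac{f_Q(r)}{r}.$$
   Context: A network $Q$ is a connected metric graph made of vertices and arcs (possibly unbounded), with a distinguished root vertex $O$, endowed with Lebesgue (length) measure $\lambda$; $\mu=\lambda(Q)\in(0,\infty]$ is its total measure. $d(x,y)$ is the length of a shortest path from $x$ to $y$, and $d(x)=d(O,x)$. Standing assumption: there is an integer $N$ such that $|\{x\in Q: d(x)=r\}|\le N$ for all $r>0$. For $r\ge 0$, $Q[r]=\{x\in Q: d(x)\le r\}$, $f_Q(r)=\lambda(Q[r])$, and $r_{\max}=\sup_{x\in Q}d(x)$ (possibly $\infty$). On $[0,r_{\max}]$ (on $[0,\infty)$ if $r_{\max}=\infty$) $f_Q$ is strictly increasing and piecewise linear; $g_Q$ denotes its inverse, so $g_Q(t)$ is the unique radius $r$ with $\lambda(Q[r])=t$. An expanding search is a family of connected subsets $S(t)\subset Q$, $0\le t\le\mu$ ($t<\infty$), with $S(0)=\{O\}$, $S(t)\subset S(t')$ for $t\le t'$, and $\lambda(S(t))=t$ for all $t$. The search time of $H\in Q$ is $T(S,H)=\min\{t: H\in S(t)\}$; the normalized search time is $\hat T(S,H)=T(S,H)/d(H)$ for $H\ne O$, and $\hat T(S,O)=0$. Put $\sigma_S(Q)=\sup_{H\in Q}\hat T(S,H)$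 and $\sigma(Q)=\inf_S\sigma_S(Q)$ over all (deterministic) expanding searches $S$. *)

(* Defs.v *)
From HB Require Import structures.
From mathcomp Require Import all_boot all_order all_algebra.
From mathcomp Require Import all_classical all_reals all_analysis.
Set Implicit Arguments.
Unset Strict Implicit.
Unset Printing Implicit Defensive.
Import Order.TTheory GRing.Theory Num.Theory.
Local Open Scope classical_set_scope.
Local Open Scope ring_scope.
Local Open Scope ereal_scope.

(* Vertices and arcs may be infinitely many; loops and parallel arcs are
   allowed. An arc of length +oo is a ray starting at [arc_src e]; then
   [arc_tgt e] is a junk value that nothing depends on. *)
Record metric_graph (R : realType) := MetricGraph {
  vertices : choiceType;
  arcs : choiceType;
  arc_src : arcs -> vertices;
  arc_tgt : arcs -> vertices;
  arc_len : arcs -> \bar R;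
  arc_len_gt0 : forall e, 0 < arc_len e }.

Definition interior_point (R : realType) (G : metric_graph R) :=
  {p : arcs G * R | (0 < p.2)%R && (p.2%:E < arc_len p.1)}.

Variant mgpoint (R : realType) (G : metric_graph R) : Type :=
  | Vertex of vertices G
  | Interior of interior_point G.

Definition sum_of_point (R : realType) (G : metric_graph R) (x : mgpoint G) :
    (vertices G + interior_point G)%type :=
  match x with Vertex v => inl v | Interior p => inr p end.

Definition point_of_sum (R : realType) (G : metric_graph R)
    (x : (vertices G + interior_point G)%type) : mgpoint G :=
  match x with inl v => Vertex v | inr p => Interior p end.

Lemma sum_of_pointK (R : realType) (G : metric_graph R) :
  cancel (@sum_of_point R G) (@point_of_sum R G).
Proof. by case. Qed.

HB.instance Definition _ (R : realType) (G : metric_graph R) :=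
  Choice.copy (mgpoint G) (can_type (@sum_of_pointK R G)).

(* The arc-length parametrization of the closed arc [e], meaningful for
   [0 <= s <= arc_len e]. *)
Definition arc_point (R : realType) (G : metric_graph R) (e : arcs G) (s : R) :
    mgpoint G :=
  if insub (e, s) is Some p then Interior p
  else Vertex (if (s <= 0)%R then arc_src e else arc_tgt e).

(* [walk x y l]: some finite concatenation of segments of arcs leads from [x]
   to [y] and has total length [l]. *)
Inductive walk (R : realType) (G : metric_graph R) :
    mgpoint G -> mgpoint G -> R -> Prop :=
  | walk_nil x : walk x x 0%R
  | walk_cons (e : arcs G) (s t : R) y l :
      (0 <= s)%R -> s%:E <= arc_len e -> (0 <= t)%R -> t%:E <= arc_len e ->
      walk (arc_point e t) y l ->
      walk (arc_point e s) y (`|s - t| + l)%R.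

Definition path_dist (R : realType) (G : metric_graph R) (x y : mgpoint G) :
    \bar R :=
  ereal_inf [set l%:E | l in [set l : R | walk x y l]].

Section path_metric.
Context {R : realType} {G : metric_graph R}.
Implicit Types (x y z : mgpoint G) (e l : R).

Definition path_ball x e y : Prop := path_dist x y < e%:E.

Lemma walk_ge0 x y l : walk x y l -> (0 <= l)%R.
Proof. by elim=> // *; rewrite addr_ge0. Qed.

Lemma walk_cat x y z l l' : walk x y l -> walk y z l' -> walk x z (l + l')%R.
Proof.
elim=> [x0|a s t y0 k s0 sa t0 ta _ IH] w; first by rewrite add0r.
by rewrite -addrA; apply: walk_cons => //; exact: IH.
Qed.

Lemma walk_sym x y l : walk x y l -> walk y x l.
Proof.
elim=> [x0|a s t y0 k s0 sa t0 ta _ IH]; first exact: walk_nil.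
rewrite addrC; apply: (walk_cat IH); rewrite distrC -[X in walk _ _ X]addr0.
by apply: walk_cons => //; exact: walk_nil.
Qed.

Lemma path_ballP x e y :
  path_ball x e y <-> exists2 l, walk x y l & (l < e)%R.
Proof.
split=> [/ereal_inf_lt [_ [l w <-]]|[l w le]]; first by rewrite lte_fin; exists l.
apply: (@le_lt_trans _ _ l%:E); last by rewrite lte_fin.
by apply: ereal_inf_lbound; exists l.
Qed.

Lemma path_ball_center x e : (0 < e)%R -> path_ball x e x.
Proof. by move=> e0; apply/path_ballP; exists 0%R => //; exact: walk_nil. Qed.

Lemma path_ball_sym x y e : path_ball x e y -> path_ball y e x.
Proof.
by move=> /path_ballP [l w le]; apply/path_ballP; exists l => //; exact: walk_sym.
Qed.

Lemma path_ball_triangle x y z e e' :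
  path_ball x e y -> path_ball y e' z -> path_ball x (e + e') z.
Proof.
move=> /path_ballP [l w le] /path_ballP [l' w' le']; apply/path_ballP.
by exists (l + l')%R; [exact: walk_cat w'|exact: ltrD].
Qed.

End path_metric.

HB.instance Definition _ (R : realType) (G : metric_graph R) :=
  hasNbhs.Build (mgpoint G) (nbhs_ (entourage_ (@path_ball R G))).

HB.instance Definition _ (R : realType) (G : metric_graph R) :=
  @Nbhs_isPseudoMetric.Build R (mgpoint G)
    (entourage_ (@path_ball R G)) erefl (@path_ball R G)
    path_ball_center path_ball_sym path_ball_triangle erefl.

(* Connectedness is topological, for the topology of the path metric. *)
Record network (R : realType) := Network {
  graph :> metric_graph R;
  root_vertex : vertices graph;
  network_connected : connected [set: mgpoint graph] }.

Section expanding_search.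
Context {R : realType} (Q : network R).
Implicit Types (A : set (mgpoint Q)) (r t : R) (S : R -> set (mgpoint Q)).

Definition origin : mgpoint Q := Vertex (root_vertex Q).

(* Vertices are null; on a non-measurable set this is an outer measure. *)
Definition arc_length_measure A : \bar R :=
  \esum_(e in [set: arcs Q])
    lebesgue_measure
      [set s : R | (0 < s)%R /\ s%:E < arc_len e /\ A (arc_point e s)].

Definition total_length : \bar R := arc_length_measure setT.

Definition depth (x : mgpoint Q) : \bar R := path_dist origin x.

Definition depth_ball r : set (mgpoint Q) := [set x | depth x <= r%:E].

Definition ball_length r : \bar R := arc_length_measure (depth_ball r).

Definition max_depth : \bar R := ereal_sup (range depth).

(* The inverse of [ball_length] on [0, max_depth]; 0 outside its range. *)
Definition radius_of_length t : R :=
  xget 0%R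
    [set r | (0 <= r)%R /\ r%:E <= max_depth /\ ball_length r = t%:E].

Definition search_times : set R := [set t | (0 <= t)%R /\ t%:E <= total_length].

(* Values of [S] outside [search_times] are irrelevant. *)
Definition expanding S : Prop :=
  [/\ S 0%R = [set origin],
      {in search_times, forall t, connected (S t)},
      {in search_times &, forall t t', (t <= t')%R -> S t `<=` S t'} &
      {in search_times, forall t, arc_length_measure (S t) = t%:E}].

(* An infimum, so that it also makes sense when the least time does not exist;
   it is +oo when [H] is never reached. *)
Definition search_time S (H : mgpoint Q) : \bar R :=
  ereal_inf [set t%:E | t in [set t | search_times t /\ S t H]].

Definition normalized_search_time S (H : mgpoint Q) : \bar R :=
  if H == origin then 0 else search_time S H / depth H.

Definition search_ratio S : \bar R :=
  ereal_sup (range (normalized_search_time S)).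

Definition competitive_ratio : \bar R :=
  ereal_inf [set search_ratio S | S in expanding].

Definition ball_search t : set (mgpoint Q) := depth_ball (radius_of_length t).

End expanding_search.

(* Main.v *)
Require Import Defs.
From mathcomp Require Import all_boot all_order all_algebra.
From mathcomp Require Import all_classical all_reals all_analysis.
From mathcomp Require Import measurable_realfun.
From mathcomp Require Import lra finmap.
Import Order.TTheory GRing.Theory Num.Theory numFieldNormedType.Exports.
Local Open Scope classical_set_scope.
Local Open Scope ring_scope.
Local Open Scope ereal_scope.

Set Implicit Arguments.
Unset Strict Implicit.
Unset Printing Implicit Defensive.

(** Write [f r] for [ball_length r]. Two comparisons give the competitive ratio.

    - Lower bound ([search_ratio_ge]): before time [f r] no expanding search has
      enough length to contain the ball of radius [r]. At a time [t < f r] it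
      misses a point [H] of this ball, so its normalized search time at [H] is
      at least [t / depth H >= t / r].
    - Upper bound ([ball_search_ratio_le]): the ball search reaches [H] by time
      [f (depth H)], so its normalized search time at [H] is at most
      [f r / r] for [r = depth H].

    Hence the supremum of [f r / r] is at most the competitive ratio, which is
    at most the ratio of the ball search, which is at most this supremum, as soon
    as the ball search is known to be an expanding search. That is where the work
    lies, and it comes down to three facts.

    - [f] is a continuous bijection from the radii up to [max_depth] onto the
      search times. Along an arc with ends at depths [a] and [b] and length [l]
      the depth at [s] is [min (a + s) (b + l - s)], so it is an isometry up to
      one fold. The length of an arc between two depths is therefore, up to a
      factor 2, the length of the set of depths met there. At most [N] arcs meet
      a given depth, and integrating this count shows that [f] is Lipschitz with
      constant [2 * N]. The finitely many arcs of a walk to a deep point meet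
      every smaller depth, and this makes [f] grow at rate at least [1 / 2] up
      to [max_depth]. The factors 2 are harmless: only continuity, strict growth
      and unboundedness matter.
    - Balls of positive radius are connected: the open ball is a union of walks,
      and the closed ball is its closure.
    - The ball of radius 0 is the root alone. The path distance is a priori only
      a pseudometric, but each arc at the root meets all small spheres, so at most
      [N] arcs end at the root and their lengths are bounded below. *)

(** * Walks and arcs *)

Lemma dist_min_le (R : realDomainType) (a b c d k : R) :
  (`|a - c| <= k -> `|b - d| <= k -> `|Num.min a b - Num.min c d| <= k)%R.
Proof.
rewrite !ler_norml => /andP[? ?] /andP[? ?].
by rewrite /Num.min; case: ifP => ?; case: ifP => ?; apply/andP; split; lra.
Qed.

Section walks.
Context {R : realType} {G : metric_graph R}.
Implicit Types (x y z : mgpoint G) (e : arcs G) (s t l : R).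

Definition on_arc e s : Prop := (0 <= s)%R /\ s%:E <= arc_len e.

Lemma arc_point0 e : arc_point e 0 = Vertex (arc_src e).
Proof. by rewrite /arc_point insubF ?lexx //= ltxx. Qed.

Lemma arc_point_len e l : arc_len e = l%:E -> arc_point e l = Vertex (arc_tgt e).
Proof.
move=> el; have l0 : (0 < l)%R by have := arc_len_gt0 e; rewrite el lte_fin.
by rewrite /arc_point insubF /= ?el ?ltxx ?andbF // leNgt l0.
Qed.

Lemma arc_point_interior e s : (0 < s)%R -> s%:E < arc_len e ->
  exists2 p : interior_point G, val p = (e, s) & arc_point e s = Interior p.
Proof.
move=> s0 se; rewrite /arc_point; case: insubP => [p _ vp|]; first by exists p.
by rewrite /= s0 se.
Qed.

Lemma arc_point_inj e f s t :
  (0 < s)%R -> s%:E < arc_len e -> (0 < t)%R -> t%:E < arc_len f ->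
  arc_point e s = arc_point f t -> (e, s) = (f, t).
Proof.
move=> s0 se t0 tf; have [p vp ->] := arc_point_interior s0 se.
have [q vq ->] := arc_point_interior t0 tf.
by case=> pq; rewrite -vp -vq pq.
Qed.

Lemma on_arcP e s : on_arc e s ->
  [\/ s = 0%R, arc_len e = s%:E | (0 < s)%R /\ s%:E < arc_len e].
Proof.
move=> [s0]; rewrite le_eqVlt => /predU1P[->|se]; first by constructor 2.
move: s0; rewrite le_eqVlt => /predU1P[->|s0]; first by constructor 1.
by constructor 3.
Qed.

Lemma walk_arc e s t : on_arc e s -> on_arc e t ->
  walk (arc_point e s) (arc_point e t) `|s - t|%R.
Proof.
move=> [s0 se] [t0 te]; rewrite -[X in walk _ _ X]addr0.
by apply: walk_cons => //; exact: walk_nil.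
Qed.

(** This is how distances are bounded from below: each such bound comes from a
    suitable [psi]. *)
Lemma walk_potential (psi : mgpoint G -> R) :
  (forall e s t, on_arc e s -> on_arc e t ->
    `|psi (arc_point e s) - psi (arc_point e t)| <= `|s - t|)%R ->
  forall x y l, walk x y l -> (`|psi x - psi y| <= l)%R.
Proof.
move=> psiL x y l; elim=> [z|e s t z k s0 se t0 te _ IH].
  by rewrite subrr normr0.
have := psiL e s t (conj s0 se) (conj t0 te).
have := ler_distD (psi (arc_point e t)) (psi (arc_point e s)) (psi z); lra.
Qed.

(** Cutting almost shortest walks makes up for shortest ones, which need not
    exist. *)
Lemma walk_split x y l c : walk x y l -> (0 <= c <= l)%R ->
  exists z, walk x z c /\ walk z y (l - c)%R.
Proof.
move=> w; elim: w c => [z|e s t z k s0 se t0 te w IH] c /andP[c0 cl].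
  have -> : c = 0%R by lra.
  by exists z; rewrite subr0; split; exact: walk_nil.
have [cst|cst] := leP c `|s - t|%R; last first.
  have [|z1 [w1 w2]] := IH (c - `|s - t|)%R; first by lra.
  exists z1; split; last first.
    by have -> : (`|s - t| + k - c = k - (c - `|s - t|))%R by lra.
  have -> : c = (`|s - t| + (c - `|s - t|))%R by lra.
  exact: walk_cons.
(* The cut falls within the first segment. *)
pose u := if (s <= t)%R then (s + c)%R else (s - c)%R.
have [su ut us] : [/\ `|s - u| = c, `|u - t| = `|s - t| - c
    & (Num.min s t <= u <= Num.max s t)]%R.
  rewrite /u; case: (leP s t) => st; move: cst.
    rewrite (_ : `|s - t| = t - s)%R; last by rewrite distrC ger0_norm ?subr_ge0.
    move=> cst; rewrite opprD addNKr normrN ger0_norm //; split=> //; last lra.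
    by rewrite ler0_norm; lra.
  rewrite (_ : `|s - t| = s - t)%R; last by rewrite ger0_norm ?subr_ge0 // ltW.
  move=> cst; rewrite opprB addrC subrK ger0_norm //; split=> //; last lra.
  by rewrite ger0_norm; lra.
have [u0 ue] : on_arc e u.
  split; first by move: us => /andP[+ _]; apply: le_trans; rewrite le_min s0 t0.
  have : (Num.max s t)%:E <= arc_len e by rewrite /Num.max; case: ifP.
  by apply: le_trans; rewrite lee_fin; case/andP: us.
exists (arc_point e u); split; first by rewrite -su; exact: walk_arc.
have -> : (`|s - t| + k - c = `|u - t| + k)%R by lra.
exact: walk_cons.
Qed.

End walks.

(** * The depth function *)

Section depth.
Context {R : realType} (Q : network R).
Implicit Types (x y z : mgpoint Q) (e : arcs Q) (r s t l : R).

Local Notation O := (origin Q).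

Lemma depth_le_walk x l : walk O x l -> depth x <= l%:E.
Proof. by move=> w; apply: ereal_inf_lbound; exists l. Qed.

Lemma depth_ltP x r : depth x < r%:E <-> exists2 l, walk O x l & (l < r)%R.
Proof. exact: path_ballP. Qed.

Lemma depth_ge0 x : 0 <= depth x.
Proof.
by apply: le_ereal_inf_tmp => _ [l w <-]; rewrite lee_fin; exact: walk_ge0 w.
Qed.

Lemma depth_origin : depth O = 0.
Proof.
by apply/eqP; rewrite eq_le depth_ge0 andbT; apply: depth_le_walk (walk_nil _).
Qed.

(** The points at finite distance from the root form a clopen set, hence are all
    the points. *)
Lemma depth_fin_num x : depth x \is a fin_num.
Proof.
rewrite ge0_fin_numE ?depth_ge0 //.
suff near1 y z : ball y 1%R z -> depth y < +oo -> depth z < +oo.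
  have B : [set x | depth x < +oo] = [set: mgpoint Q].
    apply: (network_connected (n := Q)).
    - by exists O; rewrite /= depth_origin.
    - exists [set x | depth x < +oo]; last by rewrite setTI.
      rewrite openE => y yoo; apply/nbhs_ballP; exists 1%R => //= z yz.
      exact: near1 yz yoo.
    - exists [set x | depth x < +oo]; last by rewrite setTI.
      move=> y cly; have [|z [zoo yz]] := cly (ball y 1%R).
        by apply/nbhs_ballP; exists 1%R => /=.
      by apply: near1 zoo; exact: ball_sym.
  by have : [set: mgpoint Q] x by []; rewrite -B.
move=> /path_ballP[l w _] yoo.
have yfin : depth y \is a fin_num by rewrite ge0_fin_numE ?depth_ge0.
have : depth y < (fine (depth y) + 1)%:E.
  by rewrite -[ltLHS]fineK // lte_fin ltrDl.
case/depth_ltP => k wk _; apply: le_lt_trans (ltry (k + l)).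
exact: depth_le_walk (walk_cat wk w).
Qed.

Lemma fineK_depth x : (fine (depth x))%:E = depth x.
Proof. by rewrite fineK // depth_fin_num. Qed.

Lemma fine_depth_ge0 x : (0 <= fine (depth x))%R.
Proof. by rewrite fine_ge0 // depth_ge0. Qed.

Lemma fine_depth_le_walk x y l : walk x y l ->
  (fine (depth y) <= fine (depth x) + l)%R.
Proof.
move=> w; rewrite -lerBlDr -lee_fin fineK_depth EFinB fineK_depth.
apply: le_ereal_inf_tmp => _ [k wk <-]; rewrite leeBlDr // -EFinD.
exact: depth_le_walk (walk_cat wk w).
Qed.

(** On a ray the target is a junk vertex, so only the source counts. The formula
    is meant for [on_arc e s], but is 1-Lipschitz for all [s]. *)
Definition arc_depth e s : R :=
  let a := (fine (depth (Vertex (arc_src e) : mgpoint Q)) + s)%R in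
  if arc_len e is l%:E then
    Num.min a (fine (depth (Vertex (arc_tgt e) : mgpoint Q)) + l - s)%R
  else a.

Lemma arc_depth_lip e s t : (`|arc_depth e s - arc_depth e t| <= `|s - t|)%R.
Proof.
rewrite /arc_depth; case: (arc_len e) => [l||] /=; last 2 first.
- by rewrite opprD addrACA subrr add0r.
- by rewrite opprD addrACA subrr add0r.
apply: dist_min_le; first by rewrite opprD addrACA subrr add0r.
by rewrite opprB addrC addrA subrK distrC.
Qed.

Lemma arc_depth_continuous e : continuous (arc_depth e).
Proof.
move=> s; apply/(@cvgrPdist_lt _ R^o) => eps eps0.
apply/nbhs_ballP; exists eps => // t st.
exact: le_lt_trans (arc_depth_lip e s t) st.
Qed.

(** A walk from the root can only come to an inner point through one of the ends
    of its arc. To turn this into a lower bound for the lengths of walks, the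
    formula on the arcs is glued with the depth of the vertices into a function
    to which [walk_potential] applies. *)
Lemma depth_arc e s : on_arc e s -> depth (arc_point e s) = (arc_depth e s)%:E.
Proof.
move=> es; pose psi x : R :=
  if x is Interior p then arc_depth (val p).1 (val p).2 else fine (depth x).
have e0 : on_arc e 0 by split; rewrite // ltW // arc_len_gt0.
have psi_arc f t : on_arc f t -> psi (arc_point f t) = arc_depth f t.
  move=> ft; have f0 : on_arc f 0 by split; rewrite // ltW // arc_len_gt0.
  case: (on_arcP ft) => [t0|fl|[t0 tf]].
  - rewrite {}t0 in ft *; rewrite arc_point0 /= /arc_depth addr0.
    case fl : (arc_len f) => [l||] //; rewrite subr0 min_l //.
    have fl' : on_arc f l.
      by rewrite /on_arc fl lexx -lee_fin -fl; split=> //; case: f0.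
    have := fine_depth_le_walk (walk_arc fl' f0).
    by rewrite subr0 arc_point0 (arc_point_len fl) ger0_norm //; case: fl'.
  - rewrite (arc_point_len fl) /= /arc_depth fl addrK min_r //.
    have := fine_depth_le_walk (walk_arc f0 ft).
    by rewrite sub0r normrN arc_point0 (arc_point_len fl) ger0_norm //; case: ft.
  - by have [p vp ->] := arc_point_interior t0 tf; rewrite /= vp.
have psiL := walk_potential (psi := psi).
apply/eqP; rewrite eq_le; apply/andP; split; last first.
  apply: le_ereal_inf_tmp => _ [l w <-]; rewrite lee_fin -psi_arc //.
  have := psiL _ _ _ _ w; rewrite /= depth_origin sub0r normrN => h.
  apply: le_trans (ler_norm _) (h _) => f t u ft fu; rewrite !psi_arc //.
  exact: arc_depth_lip.
rewrite -fineK_depth lee_fin /arc_depth.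
have := fine_depth_le_walk (walk_arc e0 es); rewrite arc_point0 sub0r normrN.
rewrite (ger0_norm (proj1 es)) => sle.
case el : (arc_len e) => [l||] //; rewrite le_min sle /=.
have le : on_arc e l by rewrite /on_arc el lexx -lee_fin -el; split=> //; case: e0.
have := fine_depth_le_walk (walk_arc le es); rewrite (arc_point_len el) -addrA.
by rewrite ger0_norm // subr_ge0 -lee_fin -el; case: es.
Qed.

Lemma arc_depth_gt0 e s : (0 < s)%R -> s%:E < arc_len e -> (0 < arc_depth e s)%R.
Proof.
move=> s0; rewrite /arc_depth.
have a0 := fine_depth_ge0 (Vertex (arc_src e)).
have b0 := fine_depth_ge0 (Vertex (arc_tgt e)).
case: (arc_len e) => [l||] //; rewrite ?lte_fin => sl; last lra.
by rewrite lt_min; apply/andP; split; lra.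
Qed.

End depth.

(** * Balls are connected *)

Section balls_connected.
Context {R : realType} (Q : network R).
Implicit Types (x y z : mgpoint Q) (e : arcs Q) (r s t l c : R).

Local Notation O := (origin Q).

Lemma on_arc_between e s t u : on_arc e s -> on_arc e t ->
  (Num.min s t <= u <= Num.max s t)%R -> on_arc e u.
Proof.
move=> [s0 se] [t0 te]; rewrite ge_min le_max => /andP[su ut]; split.
  by case/orP: su; apply: le_trans.
by case/orP: ut => ?; [apply: le_trans se|apply: le_trans te]; rewrite lee_fin.
Qed.

Lemma arc_connected e s t : on_arc e s -> on_arc e t ->
  connected (arc_point e @` [set u | Num.min s t <= u <= Num.max s t]%R).
Proof.
move=> es et; apply: connected_continuous_connected.
  by apply/connected_intervalP => u v /= + + w; lra.
apply/subspace_continuousP => u ust.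
move=> B /nbhs_ballP[eps /= eps0 uB].
apply/nbhs_ballP; exists eps => //= t' ut' st'; apply: uB.
apply/path_ballP; exists `|u - t'|%R => //.
by apply: walk_arc; apply: on_arc_between es et _.
Qed.

(** The trace of the walk, which cannot go deeper than its length allows. *)
Lemma walk_connected x y l c : walk x y l -> depth x <= c%:E ->
  exists K, [/\ connected K, K x, K y & K `<=` depth_ball (c + l)].
Proof.
move=> w; elim: w c => [z|e s t z k s0 se t0 te w IH] c xc.
  exists [set z]; split=> //; first exact: connected1.
  by rewrite addr0 => _ ->.
have es : on_arc e s by []. have et : on_arc e t by [].
have [|K [cK Kt Ky Kc]] := IH (c + `|s - t|)%R.
  rewrite -fineK_depth lee_fin.
  apply: (le_trans (fine_depth_le_walk (walk_arc es et))).
  by rewrite lerD2r -lee_fin fineK_depth.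
have st : (Num.min s t <= Num.max s t)%R by rewrite ge_min !le_max !lexx.
exists (arc_point e @` [set u | Num.min s t <= u <= Num.max s t]%R `|` K); split.
- apply: connectedU => //; last exact: arc_connected.
  exists (arc_point e t); split=> //; exists t => //=.
  by rewrite ge_min le_max !lexx !orbT.
- by left; exists s => //=; rewrite ge_min le_max !lexx.
- by right.
- move=> p [[u /= ust <-]|/Kc]; last by rewrite addrA.
  have eu := on_arc_between es et ust.
  rewrite /depth_ball /= -fineK_depth lee_fin.
  apply: (le_trans (fine_depth_le_walk (walk_arc es eu))).
  apply: lerD; first by rewrite -lee_fin fineK_depth.
  apply: (@le_trans _ _ (`|s - t|)%R); last by rewrite lerDl (walk_ge0 w).
  move: ust; rewrite /Num.min /Num.max; case: ltP => ? ?.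
    by rewrite ler0_norm ?ler0_norm; lra.
  by rewrite ger0_norm ?ger0_norm; lra.
Qed.

Lemma open_ball_connected r : connected [set x : mgpoint Q | depth x < r%:E].
Proof.
have [r0|r0] := leP r 0%R.
  have -> : [set x : mgpoint Q | depth x < r%:E] = set0.
    rewrite -subset0 => x /= xr; have := le_lt_trans (depth_ge0 x) xr.
    by rewrite lte_fin ltNge r0.
  exact: connected0.
have -> : [set x : mgpoint Q | depth x < r%:E] =
  \bigcup_(K in [set K : set (mgpoint Q) |
     [/\ connected K, K O & K `<=` [set x | depth x < r%:E]]]) K.
  apply/seteqP; split=> [x /depth_ltP[l w lr]|x [K [_ _ Kr] Kx]]; last exact: Kr.
  have [|K [cK K0 Kx Kl]] := walk_connected (c := 0) w.
    by rewrite depth_origin.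
  exists K => //; split=> // y /Kl; rewrite /depth_ball /= add0r => yl.
  by apply: le_lt_trans yl _; rewrite lte_fin.
by apply: bigcup_connected; [exists O => K []|move=> K []].
Qed.

(** An almost shortest walk to a point at depth [r] can be cut just before its end,
    at a point of smaller depth, even when there is no shortest walk. *)
Lemma depth_ball_closure r : (0 < r)%R ->
  @depth_ball R Q r = closure [set x : mgpoint Q | depth x < r%:E].
Proof.
move=> r0; apply/seteqP; split=> x xr.
  move=> B /nbhs_ballP[eps /= eps0 xB].
  pose d := (Num.min r eps / 2)%R.
  have [d0 dr deps] : [/\ 0 < d, d < r & d < eps]%R.
    by rewrite /d; case: (leP r eps); split; lra.
  have /depth_ltP[l w lrd] : depth x < (r + d)%:E.
    by apply: le_lt_trans xr _; rewrite lte_fin; lra.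
  have [ld|dl] := leP l d.
    exists O; split; first by rewrite /= depth_origin lte_fin.
    apply: xB; apply/path_ballP; exists l; [exact: walk_sym|lra].
  have [|z [xz zO]] := walk_split (c := d) (walk_sym w); first lra.
  exists z; split.
    by apply/depth_ltP; exists (l - d)%R; [exact: walk_sym|lra].
  by apply: xB; apply/path_ballP; exists d.
rewrite /depth_ball /=; apply/lee_addgt0Pr => eps eps0.
have [|y [/= yr /path_ballP[l w leps]]] := xr (ball x eps).
  by apply/nbhs_ballP; exists eps.
rewrite -fineK_depth -EFinD lee_fin.
apply: (le_trans (fine_depth_le_walk (walk_sym w))).
by apply: lerD; [rewrite -lee_fin fineK_depth ltW|exact: ltW].
Qed.

Lemma depth_ball_connected r : (0 < r)%R -> connected (@depth_ball R Q r).
Proof.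
by move=> /depth_ball_closure->; apply/connected_closure/open_ball_connected.
Qed.

End balls_connected.

(** * Finite spheres separate the root *)

Section spheres.
Context {R : realType} (Q : network R) (N : nat).
Hypothesis card_sphere : forall r : R, (0 < r)%R ->
  ([set x : mgpoint Q | depth x = r%:E] #<= `I_N)%card.
Implicit Types (x y z : mgpoint Q) (e : arcs Q) (r s t l : R).

Local Notation O := (origin Q).

(** The inner points of distinct arcs are distinct. *)
Lemma card_arcs_at_depth r (F : {fset arcs Q}) :
  (forall e, e \in F -> exists s,
    [/\ (0 < s)%R, s%:E < arc_len e & arc_depth e s = r]) ->
  (#|` F| <= N)%N.
Proof.
move=> Fr; have [->|/fset0Pn[e0 e0F]] := eqVneq F fset0; first by rewrite cardfs0.
have r0 : (0 < r)%R by have [s [s0 se <-]] := Fr _ e0F; exact: arc_depth_gt0.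
pose pos e := xget 0%R
  [set s | [/\ (0 < s)%R, s%:E < arc_len e & arc_depth e s = r]].
have posP e : e \in F -> [/\ (0 < pos e)%R, (pos e)%:E < arc_len e
    & arc_depth e (pos e) = r].
  by move=> /Fr; exact: xgetPex.
rewrite -card_le_II.
have posF : (`I_#|` F| #<= [set` F])%card.
  by have /card_eq_fsetP := erefl #|` F|; rewrite card_eq_le => /andP[].
have inj : {in [set` F] &, injective (fun e => arc_point e (pos e))}.
  move=> e f /set_mem /posP[e1 e2 _] /set_mem /posP[f1 f2 _].
  by move=> /(arc_point_inj e1 e2 f1 f2)[].
apply: (card_le_trans posF).
have := inj_card_eq inj; rewrite card_eq_le => /andP[_ h].
apply: (card_le_trans h); apply: card_le_trans (card_sphere r0).
apply: subset_card_le => _ [e /= /posP[p0 pl pr] <-].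
by rewrite /= depth_arc ?pr //; split; exact: ltW.
Qed.

Lemma arc_len_lbound (s : seq (arcs Q)) :
  exists2 eps : R, (0 < eps)%R & forall e, e \in s -> eps%:E < arc_len e.
Proof.
elim: s => [|e s [eps eps0 IH]]; first by exists 1%R.
have [d d0 de] : exists2 d : R, (0 < d)%R & d%:E < arc_len e.
  have := arc_len_gt0 e; case: (arc_len e) => [l||] // l0; last first.
    by exists 1%R; rewrite ?ltry.
  by exists (l / 2)%R; move: l0; rewrite !lte_fin => l0; lra.
exists (Num.min eps d); first by rewrite lt_min eps0.
move=> f; rewrite inE => /predU1P[->|/IH fe].
  by apply: le_lt_trans de; rewrite lee_fin ge_min lexx orbT.
by apply: le_lt_trans fe; rewrite lee_fin ge_min lexx.
Qed.

Definition root_arcs : set (arcs Q) :=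
  [set e | arc_src e = root_vertex Q \/
           (arc_len e < +oo /\ arc_tgt e = root_vertex Q)].

(** The arcs at the root of length at least [eps] all meet the sphere of radius
    [eps / 2], so [N.+1] arcs at the root would give too many points there. *)
Lemma finite_root_arcs : finite_set root_arcs.
Proof.
apply: contrapT => /(@infinite_set_fset _ _ N.+1)[F FA].
apply/negP; rewrite -leqNgt.
have [eps eps0 Feps] := arc_len_lbound F.
apply: (@card_arcs_at_depth (eps / 2)%R) => e eF.
have := Feps _ eF; have := FA _ eF; rewrite /arc_depth /=.
have dO : fine (depth (Vertex (root_vertex Q) : mgpoint Q)) = 0%R.
  by rewrite depth_origin.
have a0 := fine_depth_ge0 (Vertex (arc_src e)).
have b0 := fine_depth_ge0 (Vertex (arc_tgt e)).
case=> [src|[] + tgt].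
  case el : (arc_len e) => [l||] // leps; exists (eps / 2)%R;
    rewrite src dO add0r ?ltry; split=> //; rewrite ?lte_fin in leps *; try lra.
  by rewrite min_l //; lra.
case el : (arc_len e) => [l||] // _; rewrite lte_fin => leps.
exists (l - eps / 2)%R; rewrite tgt dO lte_fin; split; [lra|lra|].
by rewrite min_r; lra.
Qed.

(** A vertex other than the root could be at depth 0 only if there were
    arbitrarily short walks to it, all starting with an arc at the root; but
    these arcs are finitely many, so their lengths are bounded below. *)
Lemma depth_eq0 x : depth x = 0 -> x = O.
Proof.
case: x => [v|p] x0; last first.
  have /andP[p0 pl] := valP p.
  have px : arc_point (val p).1 (val p).2 = Interior p.
    by rewrite /arc_point -surjective_pairing valK.
  have := arc_depth_gt0 p0 pl; rewrite -lte_fin -depth_arc ?px ?x0 ?ltxx //.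
  by split; exact: ltW.
have [->//|vO] := eqVneq v (root_vertex Q).
have [F AF] : exists F : {fset arcs Q}, root_arcs = [set` F].
  by have /finite_fsetP[F ->] := finite_root_arcs; exists F.
have [eps eps0 Feps] := arc_len_lbound F.
have Aeps e : root_arcs e -> eps%:E < arc_len e by rewrite AF; exact: Feps.
(* The distance to the root, truncated at [eps]. As no arc at the root is shorter
   than [eps], its value at an end of an arc depends on this vertex only: 0 at the
   root and [eps] elsewhere. *)
pose h e s : R := Num.min (if arc_src e == root_vertex Q then s else eps)
  (Num.min eps (if arc_len e is l%:E then
    if arc_tgt e == root_vertex Q then (l - s)%R else eps else eps)).
pose psi x : R := match x with
  | Vertex w => if w == root_vertex Q then 0%R else eps
  | Interior q => h (val q).1 (val q).2 end.
have psi_arc f t : on_arc f t -> psi (arc_point f t) = h f t.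
  have fs : arc_src f = root_vertex Q -> eps%:E < arc_len f.
    by move=> ?; apply: Aeps; left.
  have ft : arc_len f < +oo -> arc_tgt f = root_vertex Q -> eps%:E < arc_len f.
    by move=> ? ?; apply: Aeps; right.
  move=> fot; case: (on_arcP fot) => [->|fl|[t0 tf]].
  - rewrite arc_point0 /= /h; case: eqP => [/fs|_]; last first.
      rewrite minA minxx.
      case fl : (arc_len f) ft => [l||] //= ft; rewrite ?minxx //.
      case: eqP ft => [e1|_ _]; rewrite ?minxx //.
      by move=> /(_ (ltry _) e1); rewrite lte_fin => ?; rewrite min_l; lra.
    case: (arc_len f) => [l||] //= el.
      by rewrite min_l // le_min ltW //=; case: ifP; rewrite ?lte_fin in el; lra.
    by rewrite minxx min_l // ltW.
  - have t0 : (0 < t)%R by have := arc_len_gt0 f; rewrite fl lte_fin.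
    rewrite (arc_point_len fl) /= /h fl; move: fs ft; rewrite fl.
    case: eqP => [_|_ + _].
      by rewrite subrr (min_r (ltW eps0)) min_r //; case: ifP => _ *; exact: ltW.
    case: eqP => [e1 /(_ e1)|_ _]; last by rewrite !minxx.
    by rewrite lte_fin minxx => ?; rewrite min_r; lra.
  - by have [q vq ->] := arc_point_interior t0 tf; rewrite /= vq.
suff : eps%:E <= depth (Vertex v : mgpoint Q) by rewrite x0 lee_fin leNgt eps0.
apply: le_ereal_inf_tmp => _ [l w <-]; rewrite lee_fin.
have : (`|psi O - psi (Vertex v)| <= l)%R.
  apply: walk_potential w => e s t es et; rewrite !psi_arc //.
  have d0 : (`|eps - eps| <= `|s - t|)%R by rewrite subrr normr0.
  apply: dist_min_le; first by case: ifP.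
  apply: dist_min_le => //; case: (arc_len e) => [m||] //; case: ifP => // _.
  by rewrite opprB addrC addrA subrK distrC.
by rewrite /= eqxx (negbTE vO) sub0r normrN gtr0_norm.
Qed.

End spheres.

(** * Lebesgue measure under translations, reflections and folds *)

Section lebesgue.
Context {R : realType}.
Implicit Types (A W : set (measurableTypeR R)) (a c : R).

Local Notation mu := (@lebesgue_measure R).

(** [mu] is an outer measure on all sets. *)
Lemma le_lebesgue_measure A W : A `<=` W -> mu A <= mu W.
Proof.
by move=> AW; rewrite /lebesgue_measure /lebesgue_stieltjes_measure
  /measure_extension; exact: le_mu_ext.
Qed.

Lemma measurable_shift a A : measurable A -> measurable [set x | A (x - a)%R].
Proof.
move=> mA; rewrite -[X in measurable X]setTI.
have : measurable_fun [set: measurableTypeR R]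
  (fun x : measurableTypeR R => (x - a)%R : measurableTypeR R).
  exact: measurable_funB.
by apply.
Qed.

Lemma measurable_reflect c A : measurable A -> measurable [set x | A (c - x)%R].
Proof.
move=> mA; rewrite -[X in measurable X]setTI.
have : measurable_fun [set: measurableTypeR R]
  (fun x : measurableTypeR R => (c - x)%R : measurableTypeR R).
  exact: measurable_funB.
by apply.
Qed.

Lemma lebesgue_measure_shift a A : measurable A ->
  mu [set x | A (x - a)%R] = mu A.
Proof.
move=> mA; pose f (x : measurableTypeR R) : measurableTypeR R := (x - a)%R.
rewrite -[LHS]/(pushforward mu f A); apply/esym/lebesgue_measure_unique => //=.
  exact: measurable_funB.
move=> mf _ [[p q]] _ <-; rewrite /pushforward.
have -> : f @^-1` [set` `]p, q]] = [set` `](p + a)%R, (q + a)%R]].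
  by apply/seteqP; split=> x /=; rewrite !in_itv /= /f; lra.
rewrite !lebesgue_measure_itv /= !lte_fin ltrD2r -!EFinB.
by case: ifP => // _; congr EFin; lra.
Qed.

Lemma lebesgue_measure_reflect c A : measurable A ->
  mu [set x | A (c - x)%R] = mu A.
Proof.
move=> mA; rewrite -(lebesgue_measure_shift (- c) (measurable_reflect c mA)).
rewrite -[RHS]lebesgue_measureN //; congr mu; apply/funext => x /=.
by congr A; lra.
Qed.

(** Where [f] agrees with a translation or with a reflection it preserves length,
    and [A] splits into two such parts. *)
Lemma lebesgue_measure_fold (f : measurableTypeR R -> measurableTypeR R) a c A :
  measurable_fun setT f -> measurable A -> measurable (f @` A) ->
  (forall s, A s -> f s = (a + s)%R \/ f s = (c - s)%R) ->
  mu A <= mu (f @` A) + mu (f @` A) /\ mu (f @` A) <= mu A + mu A.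
Proof.
move=> mf mA mfA fA.
pose U := A `&` [set s | (f s - s)%R = a].
have mU : measurable U.
  apply: measurableI => //; rewrite -[X in measurable X]setTI.
  have : measurable_fun [set: measurableTypeR R]
    (fun s : measurableTypeR R => (f s - s)%R : measurableTypeR R).
    exact: measurable_funB.
  by move=> /(_ measurableT [set a]); apply; exact: measurable_set1.
pose V := A `\` U.
have mV : measurable V by exact: measurableD.
have AU : A = U `|` V by rewrite /V setDUK // => ? [].
have fV s : V s -> f s = (c - s)%R.
  move=> [As]; case: (fA s As) => // fs Us; exfalso; apply: Us; split=> //=.
  by rewrite fs; lra.
have sU : [set x | U (x - a)%R] `<=` f @` A.
  by move=> x [Ax /= fx]; exists (x - a)%R => //; lra.
have sV : [set x | V (c - x)%R] `<=` f @` A.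
  by move=> x Vx; exists (c - x)%R; [case: Vx|rewrite fV //; lra].
split.
  have hU := le_lebesgue_measure sU; have hV := le_lebesgue_measure sV.
  rewrite lebesgue_measure_shift // in hU.
  rewrite lebesgue_measure_reflect // in hV.
  by rewrite {1}AU; exact: le_trans (measureU2 _ mU mV) (leeD hU hV).
have sf : f @` A `<=` [set x | U (x - a)%R] `|` [set x | V (c - x)%R].
  move=> _ [s As <-]; have [Us|Us] := pselect (U s).
    by left; rewrite /mkset; have -> : (f s - a)%R = s; [case: Us => _ /= <-; lra|].
  have Vs : V s by [].
  by right; rewrite /mkset fV //; have -> : (c - (c - s))%R = s by lra.
have mU' := measurable_shift a mU; have mV' := measurable_reflect c mV.
have hU : mu [set x | U (x - a)%R] <= mu A.
  by rewrite lebesgue_measure_shift //; apply: le_lebesgue_measure => ? [].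
have hV : mu [set x | V (c - x)%R] <= mu A.
  by rewrite lebesgue_measure_reflect //; apply: le_lebesgue_measure => ? [].
have := le_trans (le_lebesgue_measure sf) (measureU2 mu mU' mV').
by move=> h; exact: le_trans h (leeD hU hV).
Qed.

End lebesgue.

(** * Growth of the length of balls *)

Section ball_length_growth.
Context {R : realType} (Q : network R).
Implicit Types (x y z : mgpoint Q) (e : arcs Q) (r s t l : R).

Local Notation O := (origin Q).
Local Notation mu := (@lebesgue_measure R).

Definition arc_interior e : set R := [set s | (0 < s)%R /\ s%:E < arc_len e].

Definition arc_band e r r' : set R :=
  arc_interior e `&` [set s | (r < arc_depth e s <= r')%R].

Lemma arc_interior_interval e : is_interval (arc_interior e).
Proof.
move=> u v [u0 _] [_ ve] w /andP[uw wv]; split; first exact: lt_le_trans uw.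
by apply: le_lt_trans ve; rewrite lee_fin.
Qed.

Lemma measurable_arc_depth e :
  measurable_fun [set: measurableTypeR R] (arc_depth e : _ -> measurableTypeR R).
Proof. by apply: continuous_measurable_fun; exact: arc_depth_continuous. Qed.

Lemma measurable_arc_preimage e (i : interval R) :
  measurable (arc_interior e `&` arc_depth e @^-1` [set` i] :
    set (measurableTypeR R)).
Proof.
apply: measurableI.
  by apply: is_interval_measurable; exact: arc_interior_interval.
rewrite -[X in measurable X]setTI; exact: measurable_arc_depth.
Qed.

Lemma measurable_arc_ball e r : measurable
  (arc_interior e `&` [set s | arc_depth e s <= r]%R : set (measurableTypeR R)).
Proof.
rewrite (_ : [set s | _] = arc_depth e @^-1` `]-oo, r]).
  exact: measurable_arc_preimage.
by apply/seteqP; split=> s /=; rewrite in_itv.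
Qed.

Lemma measurable_arc_band e r r' :
  measurable (arc_band e r r' : set (measurableTypeR R)).
Proof.
rewrite /arc_band (_ : [set s | _] = arc_depth e @^-1` `]r, r']).
  exact: measurable_arc_preimage.
by apply/seteqP; split=> s /=; rewrite in_itv.
Qed.

(** The depths met by an arc form an interval. *)
Lemma measurable_band_depths e r r' :
  measurable (arc_depth e @` arc_band e r r' : set (measurableTypeR R)).
Proof.
have -> : arc_depth e @` arc_band e r r' =
    arc_depth e @` arc_interior e `&` [set` `]r, r']].
  apply/seteqP; split=> [_ [s [es rs] <-]|_ [[s es <-] rs]].
    by split; [exists s|rewrite /= in_itv].
  by exists s => //; split=> //; move: rs; rewrite /= in_itv.
apply: measurableI; last exact: measurable_itv.
apply: is_interval_measurable; apply/connected_intervalP.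
apply: connected_continuous_connected.
  exact/connected_intervalP/arc_interior_interval.
exact/continuous_subspaceT/arc_depth_continuous.
Qed.

Lemma band_fold e r r' :
  mu (arc_band e r r') <= mu (arc_depth e @` arc_band e r r')
                          + mu (arc_depth e @` arc_band e r r') /\
  mu (arc_depth e @` arc_band e r r') <=
    mu (arc_band e r r') + mu (arc_band e r r').
Proof.
pose a := fine (depth (Vertex (arc_src e) : mgpoint Q)).
pose c := (fine (depth (Vertex (arc_tgt e) : mgpoint Q)) + fine (arc_len e))%R.
apply: (@lebesgue_measure_fold _ _ a c).
- exact: measurable_arc_depth.
- exact: measurable_arc_band.
- exact: measurable_band_depths.
- move=> s _; rewrite /c /arc_depth -/a; case: (arc_len e) => [l||] /=;
    [|by left|by left].
  by rewrite /Num.min; case: ifP => _; [left|right].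
Qed.

Lemma ball_lengthE r : ball_length Q r =
  \esum_(e in [set: arcs Q]) mu (arc_interior e `&` [set s | arc_depth e s <= r]%R).
Proof.
apply: eq_esum => e _; congr mu; apply/seteqP; split=> s /=.
  move=> [s0 [se]]; rewrite /depth_ball /= depth_arc; last by split; exact: ltW.
  by rewrite lee_fin.
move=> [[s0 se] sr]; split=> //; split=> //.
by rewrite /depth_ball /= depth_arc ?lee_fin //; split; exact: ltW.
Qed.

Lemma ball_lengthD r r' : (r <= r')%R -> ball_length Q r' =
  ball_length Q r + \esum_(e in [set: arcs Q]) mu (arc_band e r r').
Proof.
move=> rr'; rewrite !ball_lengthE -esumD //; apply: eq_esum => e _.
rewrite -measureU; [|exact: measurable_arc_ball|exact: measurable_arc_band|].
  congr mu; apply/seteqP; split=> s.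
    move=> [es /= sr]; have [srl|srl] := leP (arc_depth e s) r; first by left.
    by right; split=> //=; rewrite srl.
  by case=> -[es /= sr]; split=> //=; lra.
by rewrite -subset0 => s [[_ /= sr] [_ /=]]; lra.
Qed.

Lemma ball_length_ge0 r : 0 <= ball_length Q r.
Proof. by rewrite ball_lengthE; exact: esum_ge0. Qed.

Lemma ball_length0 r : (r <= 0)%R -> ball_length Q r = 0.
Proof.
move=> r0; rewrite ball_lengthE; apply: esum1 => e _.
rewrite (_ : _ `&` _ = set0) ?measure0 // -subset0 => s [[s0 se] /= sr].
by have := arc_depth_gt0 s0 se; lra.
Qed.

Lemma arc_IVT e s t r : on_arc e s -> on_arc e t ->
  (arc_depth e s <= r <= arc_depth e t)%R ->
  exists2 u, on_arc e u & arc_depth e u = r.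
Proof.
move=> es et srt.
have [|||u] := @IVT R (arc_depth e) (Num.min s t) (Num.max s t) r.
- by rewrite ge_min !le_max !lexx.
- exact/continuous_subspaceT/arc_depth_continuous.
- by case: (leP s t) => _; rewrite ge_min le_max; case/andP: srt => -> ->;
    rewrite ?orbT.
- rewrite in_itv /= => ust <-; exists u => //.
  exact: on_arc_between es et ust.
Qed.

(** Intermediate values along a walk. *)
Lemma walk_depths x y l : walk x y l -> exists F : {fset arcs Q},
  forall r, depth x < r%:E -> r%:E <= depth y ->
    exists2 e, e \in F & exists2 s, on_arc e s & arc_depth e s = r.
Proof.
elim=> [z|e s t z k s0 se t0 te w [F Fr]].
  by exists fset0 => r zr rz; have := lt_le_trans zr rz; rewrite ltxx.
have es : on_arc e s by []. have et : on_arc e t by [].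
exists (e |` F)%fset => r sr rz; have [rt|tr] := leP r%:E (depth (arc_point e t)).
  exists e; first exact: fset1U1.
  apply: (arc_IVT es et); rewrite -!lee_fin -!depth_arc //.
  by rewrite (ltW sr).
have [f fF fr] := Fr r tr rz.
by exists f => //; exact: fset1Ur.
Qed.

(** Each depth below that of [x] occurs on one of the finitely many arcs of a
    walk to [x], so these arcs alone carry a fair share of the length. *)
Lemma ball_length_growth_ge x r r' : (0 <= r <= r')%R -> r'%:E <= depth x ->
  ball_length Q r + ((r' - r) / 2)%:E <= ball_length Q r'.
Proof.
move=> /andP[r0 rr'] r'x; rewrite (ball_lengthD rr') leeD2l //.
set S := \esum_(e in _) _.
suff : (r' - r)%:E <= S + S.
  by case: S => [S||]; rewrite ?leey // -?EFinD ?lee_fin; lra.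
have [l w _] : exists2 l, walk O x l & (l < fine (depth x) + 1)%R.
  by apply/depth_ltP; rewrite -[ltLHS]fineK_depth lte_fin ltrDl.
have [F Fr] := walk_depths w.
(* The depths of the ends of the arcs are set apart, because only inner points
   contribute to lengths. They form a null set. *)
pose E e : set (measurableTypeR R) := [set
  fine (depth (Vertex (arc_src e) : mgpoint Q));
  fine (depth (Vertex (arc_tgt e) : mgpoint Q))].
have mE e : measurable (E e).
  by apply: measurableU; exact: measurable_set1.
have E0 e : mu (E e) = 0.
  apply: countable_lebesgue_measure0; apply: finite_set_countable.
  exact: finite_set2.
pose W e : set (measurableTypeR R) := arc_depth e @` arc_band e r r'.
have cover : [set` `]r, r'[] `<=` \bigcup_(e in [set` F]) (W e `|` E e).
  move=> u; rewrite /= in_itv /= => /andP[ru ur'].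
  have [||e eF [s es su]] := Fr u.
  - by rewrite depth_origin lte_fin; lra.
  - by apply: le_trans r'x; rewrite lee_fin ltW.
  exists e => //; case: (on_arcP es) => [s0|el|[s0 se]].
  - by right; left; rewrite -su s0 -[arc_depth e 0]/(fine (_)%:E) -depth_arc -?s0 //
      s0 arc_point0.
  - right; right; rewrite -su -[arc_depth e s]/(fine (_)%:E) -depth_arc //.
    by rewrite (arc_point_len el).
  - by left; exists s => //; split=> //=; rewrite su ru ltW.
have finF : finite_set [set` F] by exact: finite_fset.
have -> : (r' - r)%:E = mu [set` `]r, r'[].
  rewrite lebesgue_measure_itv /= lte_fin; case: ltP => // h.
  by congr EFin; lra.
have le1 : mu [set` `]r, r'[] <= \sum_(e \in [set` F]) mu (W e `|` E e).
  apply: content_sub_fsum => // e _; apply: measurableU => //.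
  exact: measurable_band_depths.
apply: (le_trans le1).
apply: (@le_trans _ _ (\sum_(e \in [set` F])
    (mu (arc_band e r r') + mu (arc_band e r r')))).
  apply: lee_fsum => // e _; apply: (@le_trans _ _ (mu (W e) + mu (E e))).
    by apply: measureU2 => //; exact: measurable_band_depths.
  by rewrite E0 addr0; case: (band_fold e r r').
rewrite fsbig_split //=; apply: leeD; apply: esum_ge; exists [set` F] => //;
  by split.
Qed.

Section spheres.
Variable N : nat.
Hypothesis card_sphere : forall r : R, (0 < r)%R ->
  ([set x : mgpoint Q | depth x = r%:E] #<= `I_N)%card.

(** Integrate over the depths between [r] and [r'] the number of arcs that
    reach them, which is at most [N]. *)
Lemma sum_band_depths_le (A : set (arcs Q)) r r' : finite_set A -> (r <= r')%R ->
  \sum_(e \in A) mu (arc_depth e @` arc_band e r r') <= (N%:R * (r' - r))%:E.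
Proof.
move=> finA rr'.
pose W e : set (measurableTypeR R) := arc_depth e @` arc_band e r r'.
have mW e : measurable (W e) by exact: measurable_band_depths.
pose D : set (measurableTypeR R) := [set` `]r, r']].
have mD : measurable D by exact: measurable_itv.
have -> : \sum_(e \in A) mu (arc_depth e @` arc_band e r r') =
    \sum_(e \in A) \int[mu]_(x in D) (\1_(W e) x)%:E.
  apply: eq_fsbigr => e _; rewrite integral_indic //; congr mu.
  apply/esym/setIidPl => _ [s [_ sr] <-].
  by rewrite /D /= in_itv.
have mind e : measurable_fun D
    (fun x : measurableTypeR R => (\1_(W e) x)%:E : \bar R).
  by apply/measurable_EFinP; exact: measurable_indic.
rewrite -ge0_integral_fsum //.
have -> : (N%:R * (r' - r))%:E = \int[mu]_(x in D) cst (N%:R%:E) x.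
  have muD : mu D = (r' - r)%:E.
    rewrite lebesgue_measure_itv /= lte_fin; case: ltP => // h.
    by congr EFin; lra.
  by rewrite EFinM -muD; apply/esym; exact: integral_cst.
apply: ge0_le_integral => //.
- by move=> u _; apply: fsume_ge0 => // e _; rewrite lee_fin.
- by under eq_fun do rewrite fsbig_finite //; exact: emeasurable_sum.
move=> u _; rewrite fsumEFin // lee_fin fsbig_finite //=.
under eq_bigr do rewrite indicE.
pose P := [seq e <- fset_set A | u \in W e].
rewrite -natr_sum.
rewrite (_ : (\sum_(e <- fset_set A) (u \in W e))%N = #|` [fset e in P]%fset|).
  rewrite ler_nat; apply: (@card_arcs_at_depth _ Q N card_sphere u) => e.
  rewrite !inE mem_filter => /andP[/set_mem [s [[s0 se] _] su] _].
  by exists s.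
rewrite card_fseq undup_id ?filter_uniq ?fset_uniq // size_filter -sum1_count.
by rewrite [RHS]big_mkcond; apply: eq_bigr => e _; case: (_ \in _).
Qed.

Lemma ball_length_growth_le r r' : (r <= r')%R ->
  ball_length Q r' <= ball_length Q r + (2 * N%:R * (r' - r))%:E.
Proof.
move=> rr'; rewrite (ball_lengthD rr') leeD2l //.
apply: ge_ereal_sup => _ [A [finA _] <-].
apply: (@le_trans _ _ (\sum_(e \in A) (mu (arc_depth e @` arc_band e r r') +
    mu (arc_depth e @` arc_band e r r')))).
  by apply: lee_fsum => // e _; case: (band_fold e r r').
rewrite fsbig_split //=.
have h := sum_band_depths_le finA rr'.
apply: (le_trans (leeD h h)); rewrite -EFinD lee_fin; lra.
Qed.

End spheres.
End ball_length_growth.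

(** * The ball search and its ratio *)

Section ball_search.
Context {R : realType} (Q : network R) (N : nat).
Hypothesis card_sphere : forall r : R, (0 < r)%R ->
  ([set x : mgpoint Q | depth x = r%:E] #<= `I_N)%card.
Implicit Types (x y z H : mgpoint Q) (r s t : R) (S : R -> set (mgpoint Q)).

Local Notation O := (origin Q).

Lemma le_arc_length_measure (A B : set (mgpoint Q)) :
  A `<=` B -> arc_length_measure A <= arc_length_measure B.
Proof.
move=> AB; apply: le_esum => e _; apply: le_lebesgue_measure => s [s0 [se As]].
by split=> //; split=> //; exact: AB.
Qed.

Lemma le_ball_length r r' : (r <= r')%R -> ball_length Q r <= ball_length Q r'.
Proof.
move=> rr'; apply: le_arc_length_measure => x.
by rewrite /depth_ball /= => /le_trans; apply; rewrite lee_fin.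
Qed.

Lemma ball_length_fin_num r : ball_length Q r \is a fin_num.
Proof.
rewrite ge0_fin_numE ?ball_length_ge0 //.
have [r0|r0] := leP r 0%R; first by rewrite ball_length0 ?ltry.
apply: le_lt_trans (ball_length_growth_le card_sphere (ltW r0)) _.
by rewrite ball_length0 // add0e ltry.
Qed.

Lemma fineK_ball_length r : (fine (ball_length Q r))%:E = ball_length Q r.
Proof. by rewrite fineK // ball_length_fin_num. Qed.

Lemma ball_length_continuous : continuous (fun r => fine (ball_length Q r)).
Proof.
have lip s t : (s <= t)%R -> (fine (ball_length Q s) <= fine (ball_length Q t)
    <= fine (ball_length Q s) + 2 * N%:R * (t - s))%R.
  move=> st; rewrite -!lee_fin EFinD !fineK_ball_length le_ball_length //.
  exact: ball_length_growth_le.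
have k0 : (0 < 2 * N%:R + 1 :> R)%R by rewrite ltr_wpDl // mulr_ge0.
move=> r; apply/(@cvgrPdist_lt _ R^o) => eps eps0.
apply/nbhs_ballP; exists (eps / (2 * N%:R + 1))%R => /=.
  by rewrite divr_gt0.
move=> s; rewrite /ball /= ltr_pdivlMr // => rs; apply: le_lt_trans rs.
rewrite mulrDr mulr1 ler_norml; have [rs|/ltW sr] := leP r s.
  by have /andP[? ?] := lip _ _ rs; rewrite ler0_norm ?subr_le0 //; lra.
by have /andP[? ?] := lip _ _ sr; rewrite ger0_norm ?subr_ge0 //; lra.
Qed.

(** [ball_length_growth_ge] applies up to the depth of an actual point. As
    [max_depth] need not be attained, some [r1] between [r] and [r'] is used. *)
Lemma ball_length_lt r r' : (0 <= r < r')%R -> r'%:E <= max_depth Q ->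
  ball_length Q r < ball_length Q r'.
Proof.
move=> /andP[r0 rr'] r'm.
have /ereal_sup_gt[_ [x _ <-] rx] : r%:E < max_depth Q.
  by apply: lt_le_trans r'm; rewrite lte_fin.
pose r1 := Num.min r' (fine (depth x)).
have rr1 : (r < r1)%R by rewrite lt_min rr' -lte_fin fineK_depth.
apply: (@lt_le_trans _ _ (ball_length Q r1)); last first.
  by apply: le_ball_length; rewrite ge_min lexx.
have : ball_length Q r + ((r1 - r) / 2)%:E <= ball_length Q r1.
  apply: (@ball_length_growth_ge _ _ x); first by rewrite r0 ltW.
  by rewrite -fineK_depth lee_fin ge_min lexx orbT.
apply: lt_le_trans; rewrite lteDl ?ball_length_fin_num // lte_fin; lra.
Qed.

Lemma max_depth_ge0 : 0 <= max_depth Q.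
Proof. by apply: ereal_sup_ubound; exists O => //; exact: depth_origin. Qed.

(** If the depth is unbounded, so is the length of balls, since it grows at rate at
    least [1 / 2], whence the radius [2 * t]. *)
Lemma ball_length_max t : search_times Q t -> exists r,
  [/\ (0 <= r)%R, r%:E <= max_depth Q & t%:E <= ball_length Q r].
Proof.
move=> [t0 tQ]; have := max_depth_ge0; case mE : (max_depth Q) => [m||] // m0.
  exists m; split=> //; apply: (le_trans tQ); apply: le_arc_length_measure => x _.
  by rewrite /depth_ball /= -mE; apply: ereal_sup_ubound; exists x.
exists (2 * t)%R; rewrite leey; split=> //; first by rewrite mulr_ge0.
have /ereal_sup_gt[_ [x _ <-] /ltW tx] : (2 * t)%:E < max_depth Q.
  by rewrite mE ltry.
have := @ball_length_growth_ge _ _ x 0%R (2 * t)%R _ tx.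
rewrite ball_length0 // add0e lexx mulr_ge0 // => /(_ erefl).
by congr (_ <= _); congr EFin; lra.
Qed.

Lemma ball_length_surj t : search_times Q t -> exists r,
  (0 <= r)%R /\ r%:E <= max_depth Q /\ ball_length Q r = t%:E.
Proof.
move=> tQ; have [m [m0 mm tm]] := ball_length_max tQ; have [t0 _] := tQ.
have [||r] := @IVT R (fun r => fine (ball_length Q r)) 0%R m t m0.
- exact/continuous_subspaceT/ball_length_continuous.
- rewrite ge_min le_max ball_length0 //= t0 /=.
  by apply/orP; right; rewrite -lee_fin fineK_ball_length.
- rewrite in_itv /= => /andP[r0 rm] <-; exists r; split=> //.
  rewrite fineK_ball_length; split=> //.
  by apply: le_trans mm; rewrite lee_fin.
Qed.

Lemma radius_of_lengthP t : search_times Q t ->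
  (0 <= radius_of_length Q t)%R /\ (radius_of_length Q t)%:E <= max_depth Q /\
  ball_length Q (radius_of_length Q t) = t%:E.
Proof. by move=> /ball_length_surj; exact: xgetPex. Qed.

Lemma le_radius t r : search_times Q t -> (0 <= r)%R -> r%:E <= max_depth Q ->
  ball_length Q r <= t%:E -> (r <= radius_of_length Q t)%R.
Proof.
move=> /radius_of_lengthP[g0 [gm gt]] r0 rm rt; rewrite leNgt.
apply/negP => gr; move: rt; rewrite -gt leNgt ball_length_lt //.
by rewrite g0.
Qed.

Lemma search_times0 : search_times Q 0%R.
Proof. by split=> //; exact: esum_ge0. Qed.

Lemma depth_ball0 : @depth_ball R Q 0 = [set O].
Proof.
apply/seteqP; split=> x; rewrite /depth_ball /=; last first.
  by move=> ->; rewrite depth_origin.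
by move=> x0; apply: (depth_eq0 card_sphere); apply/eqP; rewrite eq_le x0 depth_ge0.
Qed.

Lemma fine_depth_gt0 x : x != O -> (0 < fine (depth x))%R.
Proof.
move=> xO; rewrite lt_neqAle fine_depth_ge0 andbT eq_sym.
apply: contra_neq xO => d0; apply: (depth_eq0 card_sphere).
by rewrite -fineK_depth d0.
Qed.

Lemma radius_of_length0 : radius_of_length Q 0 = 0%R.
Proof.
have [g0 [gm gt]] := radius_of_lengthP search_times0.
apply/eqP; move: g0; rewrite le_eqVlt => /predU1P[<-//|g0].
have := @ball_length_lt 0%R _ _ gm; rewrite gt lexx g0 => /(_ erefl).
by rewrite ball_length0 // ltxx.
Qed.

Lemma ball_search_expanding : expanding (@ball_search R Q).
Proof.
split.
- by rewrite /ball_search radius_of_length0 depth_ball0.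
- move=> t /set_mem /radius_of_lengthP[]; rewrite /ball_search le_eqVlt.
  move=> /predU1P[<- _|g0 _]; last exact: depth_ball_connected.
  by rewrite depth_ball0; exact: connected1.
- move=> t t' /set_mem tQ /set_mem t'Q tt' x; rewrite /ball_search /depth_ball /=.
  move=> /le_trans; apply; rewrite lee_fin.
  have [g0 [gm gt]] := radius_of_lengthP tQ.
  by apply: le_radius => //; rewrite gt lee_fin.
- by move=> t /set_mem /radius_of_lengthP[_ []].
Qed.

Lemma ball_search_time H :
  search_time (@ball_search R Q) H <= ball_length Q (fine (depth H)).
Proof.
rewrite -fineK_ball_length; apply: ereal_inf_lbound.
exists (fine (ball_length Q (fine (depth H)))) => //.
have tQ : search_times Q (fine (ball_length Q (fine (depth H)))).
  split; first by rewrite fine_ge0 // ball_length_ge0.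
  by rewrite fineK_ball_length; exact: le_arc_length_measure.
split=> //; rewrite /ball_search /depth_ball /= -fineK_depth lee_fin.
apply: le_radius; rewrite ?fine_depth_ge0 ?fineK_depth ?fineK_ball_length //.
by apply: ereal_sup_ubound; exists H.
Qed.

(** At a time [t < ball_length r] the set searched has too little length to contain the
    ball of radius [r]. *)
Lemma search_ratio_ge S r : expanding S -> (0 < r)%R ->
  ball_length Q r / r%:E <= search_ratio S.
Proof.
move=> [S0 _ Smono Slen] r0.
have rinv : (r%:E)^-1 = (r^-1)%:E by rewrite inver gt_eqF.
rewrite rinv -fineK_ball_length -EFinM.
(* The time [t] below is chosen so that [t / r] is [ball_length r / r - eps]. *)
apply/lee_subgt0Pr => eps eps0; rewrite -EFinB.
have ratio_ge0 : 0 <= search_ratio S.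
  apply: ereal_sup_ubound; exists O => //.
  by rewrite /normalized_search_time eqxx.
have [neg|tpos] := leP (fine (ball_length Q r) / r - eps)%R 0%R.
  by apply: le_trans ratio_ge0; rewrite lee_fin.
pose t := (fine (ball_length Q r) - eps * r)%R.
have tE : (fine (ball_length Q r) / r - eps = t / r)%R.
  by rewrite /t mulrBl mulfK // gt_eqF.
have t0 : (0 < t)%R by move: tpos; rewrite tE pmulr_lgt0 // invr_gt0.
have tr : t%:E < ball_length Q r.
  by rewrite -fineK_ball_length lte_fin /t ltrBlDr ltrDl mulr_gt0.
have tQ : search_times Q t.
  split; first exact: ltW.
  by apply: (le_trans (ltW tr)); exact: le_arc_length_measure.
have [H [Hr HS]] : exists H, depth H <= r%:E /\ ~ S t H.
  apply: contrapT => /forallNP noH.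
  have : ball_length Q r <= arc_length_measure (S t).
    apply: le_arc_length_measure => H Hr; apply: contrapT => HS.
    by apply: (noH H).
  by rewrite (Slen t (mem_set tQ)) leNgt tr.
have HO : H != O.
  apply/eqP => HO; apply: HS; rewrite HO.
  have : S 0%R O by rewrite S0.
  exact: (Smono _ _ (mem_set search_times0) (mem_set tQ) (ltW t0)).
have d0 := fine_depth_gt0 HO.
have tH : t%:E <= search_time S H.
  apply: le_ereal_inf_tmp => _ [t' [t'Q t'H] <-]; rewrite lee_fin leNgt.
  apply/negP => t't; apply: HS.
  exact: (Smono _ _ (mem_set t'Q) (mem_set tQ) (ltW t't)).
apply: (@le_trans _ _ (normalized_search_time S H)); last first.
  by apply: ereal_sup_ubound; exists H.
rewrite /normalized_search_time (negbTE HO) tE -fineK_depth inver gt_eqF //.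
apply: (@le_trans _ _ (t%:E * ((fine (depth H))^-1)%:E)).
  rewrite -EFinM lee_fin ler_pM2l // lef_pV2 ?posrE //.
  by rewrite -lee_fin fineK_depth.
by apply: lee_wpmul2r => //; rewrite lee_fin invr_ge0 ltW.
Qed.

Lemma ball_search_ratio_le : search_ratio (@ball_search R Q) <=
  ereal_sup [set ball_length Q r / r%:E | r in [set r : R | (0 < r)%R]].
Proof.
apply: ge_ereal_sup => _ [H _ <-]; rewrite /normalized_search_time.
case: ifPn => [_|HO].
  apply: (@le_trans _ _ (ball_length Q 1%R / 1%:E)).
    by rewrite inver oner_eq0 invr1 mule1 ball_length_ge0.
  by apply: ereal_sup_ubound; exists 1%R => //=.
have d0 := fine_depth_gt0 HO.
apply: (@le_trans _ _ (ball_length Q (fine (depth H)) / (fine (depth H))%:E)).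
  rewrite fineK_depth lee_wpmul2r ?ball_search_time //.
  by rewrite -fineK_depth inver gt_eqF // lee_fin invr_ge0 ltW.
by apply: ereal_sup_ubound; exists (fine (depth H)).
Qed.

End ball_search.

Theorem theorem6 (R : realType) (Q : network R)
    (total_length_gt0 : 0 < total_length Q)
    (N : nat)
    (card_sphere : forall r : R, (0 < r)%R ->
      ([set x : mgpoint Q | depth x = r%:E] #<= `I_N)%card) :
  expanding (@ball_search R Q) /\
  search_ratio (@ball_search R Q) = competitive_ratio Q /\
  competitive_ratio Q =
    ereal_sup [set ball_length Q r / r%:E | r in [set r : R | (0 < r)%R]].
Proof.
have exp := ball_search_expanding card_sphere.
have le1 := ball_search_ratio_le card_sphere.
have le2 : competitive_ratio Q <= search_ratio (@ball_search R Q).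
  by apply: ereal_inf_lbound; exists (@ball_search R Q).
have le3 : ereal_sup [set ball_length Q r / r%:E | r in [set r : R | (0 < r)%R]]
    <= competitive_ratio Q.
  apply: le_ereal_inf_tmp => _ [S Sexp <-]; apply: ge_ereal_sup => _ [r r0 <-].
  exact: (search_ratio_ge card_sphere Sexp r0).
split=> //; split; apply/eqP; rewrite eq_le; apply/andP; split=> //.
  exact: le_trans le1 le3.
exact: le_trans le2 le1.
Qed.
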